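(* There is a universal constant $K$ such that the following holds. Let $N\ge3$, let $I,J$ be two disjoint sets of cardinality $N$, let $(X_{i,j})_{i\in I,j\in J}$ be independent random variables uniformly distributed over $[0,1]$, and let $$L_N=\inf\Big\{\sum_{i\in I}X_{i,\tau(i)} : \tau \text{ a one-to-one map from } I \text{ to } J\Big\}.$$ Let $M$ be a median of $L_N$. Then $$0\le t\le\sqrt{\log N}\ \Rightarrow\ P\Big(|L_N-M|\ge\frac{Kt(\log N)^2}{\sqrt N\log\log N}\Big)\le2\exp(-t^2),$$ $$t\ge\sqrt{\log N}\ \Rightarrow\ P\Big(|L_N-M|\ge\frac{Kt^3\log N}{\sqrt N\log t^2}\Big)\le2\exp(-t^2).$$
   Context: $\log$ denotes the natural logarithm. *)

(* Defs.v *)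
From HB Require Import structures.
From mathcomp Require Import all_boot all_order all_algebra finmap.
From mathcomp Require Import all_classical all_reals all_analysis.

Set Implicit Arguments.
Unset Strict Implicit.
Unset Printing Implicit Defensive.

Import Order.TTheory GRing.Theory Num.Theory.
Import numFieldNormedType.Exports.

Local Open Scope classical_set_scope.
Local Open Scope ring_scope.

(* Mutual independence: the product rule holds for every finite subfamily. *)
Definition independent_RVs (d : measure_display) (T : measurableType d) (R : realType)
    (P : probability T R) (K : choiceType) (X : K -> {RV P >-> R}) : Prop :=
  forall (F : {fset K}) (A : K -> set R),
    (forall k, k \in F -> measurable (A k)) ->
    P (\bigcap_(k in [set` F]) (X k @^-1` A k)) =
    (\prod_(k <- F) P (X k @^-1` A k))%E.

Definition uniform01 (d : measure_display) (T : measurableType d) (R : realType)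
    (P : probability T R) (X : {RV P >-> R}) : Prop :=
  forall A : set R, measurable A ->
    distribution P X A = uniform_prob (@ltr01 R) A.

(* A median need not be unique. *)
Definition is_median (d : measure_display) (T : measurableType d) (R : realType)
    (P : probability T R) (Y : T -> R) (M : R) : Prop :=
  ((2^-1)%:E <= P [set w | (Y w <= M)%R])%E /\
  ((2^-1)%:E <= P [set w | (M <= Y w)%R])%E.

Definition assignment_cost (R : realType) (T : Type) (I J : finType)
    (X : I * J -> T -> R) (w : T) : R :=
  inf [set \sum_(i : I) X (i, tau i) w | tau in [set tau : I -> J | injective tau]].

(* Main.v *)
Require Import Defs.
From HB Require Import structures.
From mathcomp Require Import all_boot all_order all_algebra finmap.
From mathcomp Require Import all_classical all_reals all_analysis.
From mathcomp Require Import ring lra zify.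

Set Implicit Arguments.
Unset Strict Implicit.
Unset Printing Implicit Defensive.

Import Order.TTheory GRing.Theory Num.Theory.
Import numFieldNormedType.Exports.

Local Open Scope classical_set_scope.
Local Open Scope ring_scope.

(** Every row of [X] moves the truncated cost, in which each entry [x] is
replaced by [min x u], by at most [u]; the method of bounded differences,
applied to the [N] independent rows, hence concentrates it at the scale
[u * sqrt N]. The truncation is harmless once [u] is about
[lam * log N / (N * log lam)] with [lam >= log N]: off an event of probability
[exp (- 3 lam)] the bipartite graph of the entries at most [96 lam / N] expands
every set by a factor [lam], so an optimal assignment using an entry above [u]
could be rerouted along an alternating cycle of length of order
[log N / log lam] made of these small entries, and would become cheaper. The two
regimes of the theorem are [lam = log N] and [lam = t ^ 2]. Everything is done
for entries rounded down to a grid of mesh [1 / m], where probabilities are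
counts; [m] is then taken large. *)

(** * Elementary exponential inequalities *)

Lemma expR_le_invB (R : realType) (x : R) : x < 1 -> expR x <= (1 - x)^-1.
Proof.
move=> x1; rewrite -[x in expR x]opprK expRN lef_pV2 ?posrE ?expR_gt0 ?subr_gt0//.
exact: expR_ge1Dx.
Qed.

(** The linear term vanishes on averaging a centred variable, which leaves a Gaussian factor. Near
    [0] the bound goes through [(1 - x / 2) ^- 2 <= 1 + x + x ^+ 2]; elsewhere [3 * x ^+ 2]
    dominates [|x|]. *)
Lemma expR_le_addr_expR_sqr (R : realType) (x : R) :
  expR x <= x + expR (3 * x ^+ 2).
Proof.
have e1 : 1 + 3 * x ^+ 2 <= expR (3 * x ^+ 2) by exact: expR_ge1Dx.
have [x13|x13] := lerP x (3^-1); last first.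
  have : expR x <= expR (3 * x ^+ 2) by rewrite ler_expR; nra.
  lra.
have [x0|x0] := lerP x (- 3^-1).
  have : expR x <= 1 by rewrite expR_le1; lra.
  nra.
have h : expR x <= (1 - x / 2) ^- 2.
  rewrite [x in expR x](_ : x = 2%:R * (x / 2)); last by rewrite mulrC divfK.
  rewrite expRM_natl -exprVn ler_pXn2r// ?nnegrE ?expR_ge0 ?invr_ge0//; last by lra.
  by apply: expR_le_invB; lra.
apply: (le_trans h); apply: le_trans (_ : 1 + x + x ^+ 2 <= _); last nra.
have d0 : 0 < (1 - x / 2) ^+ 2 by rewrite exprn_gt0//; lra.
rewrite -[X in X <= _]mul1r ler_pdivrMr//.
suff : 0 <= x ^+ 2 * (1 - 3 * x + x ^+ 2) by nra.
by apply: mulr_ge0; nra.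
Qed.

(** * Uniform averages over finite types *)

Definition mean (R : realType) (V : finType) (g : V -> R) : R :=
  (\sum_v g v) / #|V|%:R.

Section mean_theory.
Variables (R : realType) (V : finType).
Hypothesis V0 : (0 < #|V|)%N.
Implicit Types g h : V -> R.

Let card_gt0R : (0 : R) < #|V|%:R. Proof. by rewrite ltr0n. Qed.

Lemma eq_mean g h : g =1 h -> mean g = mean h.
Proof. by move=> gh; rewrite /mean (eq_bigr h). Qed.

Lemma ler_mean g h : (forall v, g v <= h v) -> mean g <= mean h.
Proof. by move=> gh; rewrite ler_wpM2r ?invr_ge0 ?ler0n// ler_sum. Qed.

Lemma mean_cst (c : R) : mean (fun _ : V => c) = c.
Proof. by rewrite /mean sumr_const -(mulr_natr c) mulfK// gt_eqF. Qed.

Lemma meanD g h : mean (fun v => g v + h v) = mean g + mean h.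
Proof. by rewrite /mean big_split/= mulrDl. Qed.

Lemma meanZ (c : R) g : mean (fun v => c * g v) = c * mean g.
Proof. by rewrite /mean -mulr_sumr mulrA. Qed.

Lemma meanN g : mean (fun v => - g v) = - mean g.
Proof. by rewrite /mean sumrN mulNr. Qed.

(** A form of Hoeffding's lemma, with [3] in place of the sharp [1/8]: [g] stays within [u] of its
    mean, and the linear term averages to zero. *)
Lemma mean_expR_le g (u th : R) : (forall v w, `|g v - g w| <= u) ->
  mean (fun v => expR (th * g v)) <= expR (3 * th ^+ 2 * u ^+ 2 + th * mean g).
Proof.
move=> gu; have dev v : `|g v - mean g| <= u.
  rewrite ler_norml; apply/andP; split.
    have : mean g <= mean (fun _ : V => g v + u).
      by apply: ler_mean => w; have := gu v w; rewrite ler_norml; lra.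
    by rewrite mean_cst; lra.
  have : mean (fun _ : V => g v - u) <= mean g.
    by apply: ler_mean => w; have := gu v w; rewrite ler_norml; lra.
  by rewrite mean_cst; lra.
have step v : expR (th * g v) <= expR (th * mean g) *
   (th * (g v - mean g) + expR (3 * th ^+ 2 * u ^+ 2)).
  rewrite -[in X in X <= _](subrK (mean g) (g v)) mulrDr addrC expRD.
  rewrite ler_pM2l ?expR_gt0//.
  apply: le_trans (expR_le_addr_expR_sqr _) _; rewrite lerD2l ler_expR exprMn.
  rewrite mulrA; apply: ler_wpM2l; first by rewrite mulr_ge0// sqr_ge0.
  have := dev v; rewrite ler_norml => /andP[a b].
  by rewrite -subr_ge0 subr_sqr mulr_ge0//; lra.
apply: le_trans (ler_mean step) _; rewrite !meanZ meanD meanZ meanD !mean_cst.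
by rewrite subrr mulr0 add0r expRD mulrC.
Qed.

End mean_theory.

(** Independence of the coordinates under the uniform law on a product. *)
Lemma mean_prod (R : realType) (K V : finType) (F : K -> V -> R) :
  mean (fun y : {ffun K -> V} => \prod_k F k (y k)) = \prod_k mean (F k).
Proof.
by rewrite /mean -bigA_distr_bigA big_split/= prodr_const card_ffun natrX exprVn.
Qed.

(** * Probabilities as proportions *)

Definition prob (R : realType) (V : finType) (A : pred V) : R :=
  mean (fun v => (A v)%:R).

Section prob_theory.
Variables (R : realType) (V : finType).
Hypothesis V0 : (0 < #|V|)%N.
Implicit Types A B : pred V.

Lemma prob_card A : prob R A = #|A|%:R / #|V|%:R.
Proof.
rewrite /prob /mean -sum1_card natr_sum; congr (_ / _); rewrite [RHS]big_mkcond/=.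
by apply: eq_bigr => v _; rewrite unfold_in /=; case: (A v).
Qed.

Lemma ler_prob A B : subpred A B -> prob R A <= prob R B.
Proof.
by move=> AB; apply: ler_mean => v; rewrite ler_nat; case: (A v) (AB v) => // ->.
Qed.

Lemma probU A B : prob R (predU A B) <= prob R A + prob R B.
Proof.
rewrite -meanD; apply: ler_mean => v /=.
by case: (A v); case: (B v); rewrite /= ?(addr0, add0r)// lerDl.
Qed.

Lemma prob_exists (S : finType) (F : S -> pred V) (Q : pred S) :
  prob R (fun v => [exists s, Q s && F s v]) <= \sum_(s | Q s) prob R (F s).
Proof.
rewrite /prob /mean -mulr_suml ler_wpM2r ?invr_ge0 ?ler0n// exchange_big/=.
apply: ler_sum => v _; case: existsP => [[s /andP[Qs Fs]]|_]; last exact: sumr_ge0.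
by rewrite (bigD1 s)//= Fs lerDl sumr_ge0.
Qed.

Lemma prob_expR_le (g : V -> R) (a th : R) : 0 <= th ->
  prob R (fun v => a <= g v) <= expR (- (th * a)) * mean (fun v => expR (th * g v)).
Proof.
move=> th0; rewrite -meanZ; apply: ler_mean => v; rewrite -expRD.
case: (lerP a (g v)) => [av|_] /=; last exact: expR_ge0.
by rewrite -expR0 ler_expR; have := ler_wpM2l th0 av; lra.
Qed.

End prob_theory.

(** * The method of bounded differences *)

Section bounded_differences.
Variables (R : realType) (I V : finType).
Hypothesis V0 : (0 < #|V|)%N.
Implicit Types (f : {ffun I -> V} -> R) (y : {ffun I -> V}) (i k : I) (v w : V).

Definition resample y i v : {ffun I -> V} := [ffun k => if k == i then v else y k].

Definition avg i f y : R := mean (fun v => f (resample y i v)).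

Lemma resample_id y i : resample y i (y i) = y.
Proof. by apply/ffunP => k; rewrite ffunE; case: eqP => // ->. Qed.

Lemma resample_resample y i v w : resample (resample y i v) i w = resample y i w.
Proof. by apply/ffunP => k; rewrite !ffunE; case: eqP. Qed.

Lemma resampleC y i k v w : k != i ->
  resample (resample y k v) i w = resample (resample y i w) k v.
Proof.
move=> ki; apply/ffunP => l; rewrite !ffunE; case: eqP => [->|//].
by rewrite eq_sym (negPf ki).
Qed.

Lemma card_ffun_gt0 : (0 < #|{ffun I -> V}|)%N.
Proof. by rewrite card_ffun expn_gt0 V0. Qed.

(* Swapping [v] with [y i] is an involution on the pairs [(y, v)]. *)
Lemma mean_avg i f : mean (avg i f) = mean f.
Proof.
rewrite /mean /avg /mean -mulr_suml.
suff -> : \sum_y \sum_v f (resample y i v) = (\sum_y f y) * #|V|%:R.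
  by rewrite mulfK// pnatr_eq0 -lt0n.
pose swap (p : {ffun I -> V} * V) := (resample p.1 i p.2, p.1 i).
have swapK : involutive swap.
  case=> y v; rewrite /swap/= resample_resample resample_id.
  by rewrite ffunE eqxx.
rewrite pair_big/=.
rewrite -[LHS](@reindex_inj _ _ _ _ _ xpredT (fun p => f p.1) (inv_inj swapK))/=.
rewrite -(pair_big xpredT xpredT (fun y (_ : V) => f y))/= mulr_suml.
by apply: eq_bigr => y _; rewrite sumr_const mulr_natr.
Qed.

Lemma avg_resample i f y v : avg i f (resample y i v) = avg i f y.
Proof. by apply: eq_mean => w; rewrite resample_resample. Qed.

Definition bounded_diff (u : R) f :=
  forall y i v, `|f (resample y i v) - f y| <= u.

Lemma bounded_diff_avg u i f : bounded_diff u f -> bounded_diff u (avg i f).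
Proof.
move=> fu y k v; have [->|ki] := eqVneq k i.
  by rewrite avg_resample subrr normr0 (le_trans _ (fu y k v)).
rewrite /avg ler_norml -meanN -meanD.
have h w : `|f (resample (resample y k v) i w) - f (resample y i w)| <= u.
  by rewrite resampleC.
rewrite -{1}(mean_cst V0 (- u)) -{2}(mean_cst V0 u).
by apply/andP; split; apply: ler_mean => w; have := h w; rewrite ler_norml => /andP[].
Qed.

(** Plays the role of a conditional expectation: as [s] grows to [enum I], these functions form the
    Doob martingale of [f]. *)
Definition avgs s f := foldr avg f s.

Lemma bounded_diff_avgs u s f : bounded_diff u f -> bounded_diff u (avgs s f).
Proof. by elim: s => //= i s ih /ih; exact: bounded_diff_avg. Qed.

Lemma avgs_resample s f y i v : i \in s -> avgs s f (resample y i v) = avgs s f y.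
Proof.
elim: s y => //= k s ih y; rewrite inE; have [<-|ik] := eqVneq i k.
  by rewrite avg_resample.
by move=> /= /ih{}ih; apply: eq_mean => w; rewrite resampleC.
Qed.

(** Once every coordinate is averaged out the function is constant, and each averaging preserves the
    mean. *)
Lemma avgs_enum f y : avgs (enum I) f y = mean f.
Proof.
have avgs_cst y1 y2 : avgs (enum I) f y1 = avgs (enum I) f y2.
  (* Pass from [y1] to [y2] by changing one coordinate at a time. *)
  suff h s : avgs (enum I) f (foldr (fun i z => resample z i (y2 i)) y1 s) =
             avgs (enum I) f y1.
    rewrite -(h (enum I)); congr avgs; apply/ffunP => i.
    have : i \in enum I by rewrite mem_enum.
    elim: (enum I) => //= k s ih; rewrite inE ffunE.
    by case: eqP => [->//|_ /=].
  elim: s => //= i s ih.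
  by rewrite avgs_resample ?mem_enum.
rewrite -(mean_cst card_ffun_gt0 (avgs _ _ _)).
rewrite (@eq_mean _ _ _ (avgs (enum I) f)); last by move=> z; exact: avgs_cst.
by elim: (enum I) => //= i s <-; exact: mean_avg.
Qed.

(** Each coordinate averaged out costs one factor [expR (3 * th ^+ 2 * u ^+ 2)], by [mean_expR_le],
    since averaging the others keeps the differences bounded. *)
Lemma mean_expR_avgs u s f (th : R) : bounded_diff u f ->
  mean (fun y => expR (th * f y)) <=
  expR (3 * th ^+ 2 * u ^+ 2 * (size s)%:R) * mean (fun y => expR (th * avgs s f y)).
Proof.
move=> fu; elim: s => [|i s ih] /=; first by rewrite mulr0 expR0 mul1r.
apply: (le_trans ih); rewrite -[(size s).+1%:R]natr1 mulrDr mulr1 expRD.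
rewrite -[leRHS]mulrA ler_pM2l ?expR_gt0//.
(* By [mean_avg], the left side may first be averaged over coordinate [i], with the others
   frozen. *)
rewrite -meanZ -(mean_avg i (fun y => expR _)); apply: ler_mean => y.
rewrite -expRD; apply: (mean_expR_le V0) => v w.
have := bounded_diff_avgs s fu (resample y i w) i v.
by rewrite resample_resample.
Qed.

Lemma mean_expR_bounded_diff u f (th : R) : bounded_diff u f ->
  mean (fun y => expR (th * f y)) <=
  expR (3 * th ^+ 2 * u ^+ 2 * #|I|%:R + th * mean f).
Proof.
move=> fu; apply: (le_trans (mean_expR_avgs (enum I) th fu)).
rewrite -cardE expRD ler_pM2l ?expR_gt0//.
under eq_mean do rewrite avgs_enum.
by rewrite (mean_cst card_ffun_gt0).
Qed.

Lemma bounded_diff_upper_tail u f (s : R) : (0 < #|I|)%N -> 0 < u -> 0 <= s ->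
  bounded_diff u f ->
  prob R (fun y => mean f + s <= f y) <= expR (- (s ^+ 2 / (12 * #|I|%:R * u ^+ 2))).
Proof.
move=> I0 u0 s0 fu; have n0 : (0 : R) < #|I|%:R by rewrite ltr0n.
(* The minimiser of [3 * th ^+ 2 * u ^+ 2 * #|I| - th * s]. *)
set th := s / (6 * #|I|%:R * u ^+ 2).
have th0 : 0 <= th by rewrite divr_ge0// !mulr_ge0// ltW.
apply: le_trans (prob_expR_le f _ th0) _.
apply: le_trans (ler_wpM2l (expR_ge0 _) (mean_expR_bounded_diff th fu)) _.
rewrite -expRD ler_expR /th le_eqVlt; apply/orP; left; apply/eqP.
by field; rewrite !gt_eqF.
Qed.

Lemma bounded_diff_lower_tail u f (s : R) : (0 < #|I|)%N -> 0 < u -> 0 <= s ->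
  bounded_diff u f ->
  prob R (fun y => f y <= mean f - s) <= expR (- (s ^+ 2 / (12 * #|I|%:R * u ^+ 2))).
Proof.
move=> I0 u0 s0 fu.
have fNu : bounded_diff u (fun y => - f y).
  by move=> y i v; rewrite -opprD normrN.
apply: le_trans (bounded_diff_upper_tail I0 u0 s0 fNu).
by apply: ler_prob => y; rewrite meanN -lerN2 opprB addrC.
Qed.

End bounded_differences.

(** * Expansion of random bipartite graphs *)

(** Lowering the upper index from [a] to [a - 1] multiplies the binomial by [(a - k) / a], which is
    at least [1/4] as long as [4 * k <= 3 * a]. *)
Lemma leq_bin_subn (n g k : nat) : (4 * k <= 3 * (n - g))%N ->
  ('C(n, k) <= 4 ^ g * 'C(n - g, k))%N.
Proof.
elim: g => [|g ih] h; first by rewrite subn0 mul1n.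
have {ih} : ('C(n, k) <= 4 ^ g * 'C(n - g, k))%N by apply: ih; lia.
move=> /leq_trans; apply; rewrite expnSr -mulnA leq_mul2l; apply/orP; right.
have [a0|a0] := posnP (n - g); first by have -> : k = 0 by [lia]; rewrite !bin0.
rewrite -(leq_pmul2l a0) mulnCA subnS mul_bin_down mulnA leq_mul2r.
by apply/orP; right; lia.
Qed.

Lemma card_set_type (T : finType) : #|{set T}| = (2 ^ #|T|)%N.
Proof.
rewrite -[#|T|]cardsT -card_powerset; apply: eq_card => A.
by rewrite powersetE finset.subsetT.
Qed.

Section random_bipartite_graph.
Variable (R : realType).
Implicit Types (I J : finType) (lam v : R).

Definition neighbours I J (e : I -> J -> bool) (S : {set I}) : {set J} :=
  [set j | [exists i in S, e i j]].

Definition unlinked I J (e : I -> J -> bool) (S : {set I}) (W : {set J}) : bool :=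
  [forall i in S, forall j in W, ~~ e i j].

(** The cap at a quarter of [J] makes the condition reasonable for large [S] too. *)
Definition expanding lam I J (e : I -> J -> bool) : bool :=
  [forall S : {set I}, (S != finset.set0) ==>
    (Num.min (lam * #|S|%:R) (#|J|%:R / 4) <= #|neighbours e S|%:R)].

Definition well_linked I J (e : I -> J -> bool) : bool :=
  [forall A : {set I}, forall B : {set J},
    [&& #|I|%:R / 4 <= #|A|%:R :> R, #|J|%:R / 4 <= #|B|%:R :> R & unlinked e A B]
    ==> false].

(** Holds for independent edges, each absent with probability at most [expR (- v)]. The expansion
    estimates use nothing else about the randomness. *)
Definition sparsely_unlinked (V : finType) v I J (e : V -> I -> J -> bool) :=
  forall (S : {set I}) (W : {set J}),
  prob R (fun y => unlinked (e y) S W) <= expR (- (v * #|S|%:R * #|W|%:R)).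

Lemma unlinkedE I J (e : I -> J -> bool) S W :
  unlinked e S W = (W \subset ~: neighbours e S).
Proof.
apply/forall_inP/fintype.subsetP => [h j jW|h i iS].
  rewrite !inE; apply/existsP => -[i /andP[iS eij]].
  by have /forall_inP/(_ j jW) := h i iS; rewrite eij.
apply/forall_inP => j /h; rewrite !inE; apply: contra => eij.
by apply/existsP; exists i; rewrite iS.
Qed.

Lemma unlinked_flip I J (e : I -> J -> bool) S W :
  unlinked (fun j i => e i j) W S = unlinked e S W.
Proof.
by apply/forall_inP/forall_inP => h x xS; apply/forall_inP => y yS;
  have /forall_inP := h y yS; exact.
Qed.

Lemma sparsely_unlinked_flip (V : finType) v I J (e : V -> I -> J -> bool) :
  sparsely_unlinked v e -> sparsely_unlinked v (fun y j i => e y i j).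
Proof.
move=> ev S W; rewrite mulrAC; apply: le_trans (ev W S).
by apply: ler_prob => y; rewrite unlinked_flip.
Qed.

Lemma expR1_ge2 : 2 <= expR 1 :> R.
Proof. by have := expR_ge1Dx (1 : R); lra. Qed.

Lemma expr4_le_expR (g : nat) (a : R) : g%:R <= a -> 4 ^+ g <= expR (2 * a).
Proof.
move=> ga; apply: (@le_trans _ _ (expR (g%:R * 2))).
  rewrite expRM_natl lerXn2r ?nnegrE ?expR_ge0//.
  rewrite (_ : 2 = 1 + 1 :> R)// expRD.
  by have := expR1_ge2; nra.
by rewrite ler_expR; lra.
Qed.

Lemma sum_expr_card I (a : R) : \sum_(S : {set I}) a ^+ #|S| = (1 + a) ^+ #|I|.
Proof.
rewrite -[in RHS]prodr_const addrC bigA_distr.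
apply: eq_bigr => S _; rewrite -big_mkcond/= prodr_const.
by congr (_ ^+ _); apply: eq_card => i; rewrite inE.
Qed.

(* Averaging over all [W] with half the size of [J] instead of a union bound
   over the possible values of the neighbourhood of [S]: when the latter has
   [g < #|J| / 4] elements, a fraction at least [4 ^- g] of these [W] avoid it. *)
Lemma prob_few_neighbours (V : finType) v lam I J (e : V -> I -> J -> bool)
    (S : {set I}) : (0 < #|V|)%N -> 0 <= lam -> sparsely_unlinked v e ->
  prob R (fun y => #|neighbours (e y) S|%:R < Num.min (lam * #|S|%:R) (#|J|%:R / 4))
  <= expR (2 * (lam * #|S|%:R) - v * #|S|%:R * (#|J|./2)%:R).
Proof.
move=> V0 lam0 ev; set k := #|J|./2; set B := fun y => _.
have C0 : (0 : R) < 'C(#|J|, k)%:R.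
  by rewrite ltr0n bin_gt0 /k -divn2 leq_div.
rewrite -(ler_pM2r C0) mulrC -meanZ.
have step y : 'C(#|J|, k)%:R * (B y)%:R <= expR (2 * (lam * #|S|%:R)) *
    \sum_(W : {set J} | #|W| == k) (unlinked (e y) S W)%:R.
  case By : (B y); last by rewrite mulr0 mulr_ge0 ?expR_ge0// sumr_ge0.
  move: By; rewrite /B lt_min mulr1 => /andP[].
  set g := #|_| => gS gJ.
  have gJ4 : (4 * g < #|J|)%N.
    by rewrite -(ltr_nat R) natrM; lra.
  have : ('C(#|J|, k) <= 4 ^ g * 'C(#|J| - g, k))%N.
    by apply: leq_bin_subn; rewrite /k; lia.
  rewrite -(ler_nat R) => /le_trans; apply; rewrite natrM natrX.
  apply: ler_pM => //; first by apply: expr4_le_expR; exact: ltW.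
  have -> : (#|J| - g)%N = #|~: neighbours (e y) S|.
    by rewrite [RHS]cardsCs finset.setCK.
  rewrite -cards_draws -sum1_card natr_sum.
  rewrite [leRHS]big_mkcond [leLHS]big_mkcond/=; apply: ler_sum => W _.
  by rewrite inE unlinkedE; case: (_ \subset _); case: (_ == _).
apply: le_trans (ler_mean step) _.
rewrite meanZ expRD -[leRHS]mulrA ler_pM2l ?expR_gt0//.
rewrite /mean exchange_big/= mulr_suml.
apply: (@le_trans _ _ (\sum_(W : {set J} | #|W| == k)
    expR (- (v * #|S|%:R * k%:R)))).
  by apply: ler_sum => W /eqP <-; exact: ev.
rewrite sumr_const -(card_draws J k) [leRHS]mulr_natr le_eqVlt; apply/orP; left.
by apply/eqP; congr (_ *+ _); apply: eq_card => W; rewrite !inE.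
Qed.

(** Union bound over the non-empty [S], a set of size [s] contributing [a ^+ s] with
    [a = expR (- (30 * lam))]. The total is [(1 + a) ^+ N - 1 <= 2 * N * a], and [N <= expR lam]
    absorbs the factor [N]. *)
Lemma prob_not_expanding (V : finType) lam I J (e : V -> I -> J -> bool) :
  (0 < #|V|)%N -> (1 < #|J|)%N -> #|I| = #|J| ->
  1 <= lam -> #|J|%:R <= expR lam ->
  sparsely_unlinked (96 * lam / #|J|%:R) e ->
  prob R (fun y => ~~ expanding lam (e y)) <= 2 * expR (- (29 * lam)).
Proof.
move=> V0 J1 IJ lam1 Jlam ev; set N := #|J| in J1 IJ Jlam ev *.
have N0 : (0 : R) < N%:R by rewrite ltr0n; lia.
pose a : R := expR (- (30 * lam)).
have a0 : 0 < a by exact: expR_gt0.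
have Na : N%:R * a <= expR (- (29 * lam)).
  apply: (@le_trans _ _ (expR lam * a)); first by rewrite ler_pM2r.
  by rewrite /a -expRD ler_expR; lra.
have Na2 : expR (- (29 * lam)) <= 2^-1 :> R.
  apply: (@le_trans _ _ (expR (- 1))); first by rewrite ler_expR; lra.
  by rewrite expRN lef_pV2 ?posrE ?expR_gt0// expR1_ge2.
have few (S : {set I}) :
    prob R (fun y => #|neighbours (e y) S|%:R < Num.min (lam * #|S|%:R) (N%:R / 4))
    <= a ^+ #|S|.
  apply: le_trans (prob_few_neighbours _ V0 _ ev) _; first by lra.
  rewrite -expRM_natl ler_expR -/N.
  (* With [N./2 >= N / 3] the exponent is at most [(2 - 96 / 3) * lam * #|S|]. *)
  have k3 : N%:R / 3 <= (N./2)%:R :> R.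
    by rewrite ler_pdivrMr// -natrM ler_nat; lia.
  have s0 : (0 : R) <= #|S|%:R by [].
  have : 96 * lam / N%:R * (N%:R / 3) <= 96 * lam / N%:R * (N./2)%:R.
    by rewrite ler_wpM2l// divr_ge0//; lra.
  rewrite (_ : 96 * lam / N%:R * (N%:R / 3) = 32 * lam); last first.
    by field; rewrite gt_eqF.
  by nra.
have -> : prob R (fun y => ~~ expanding lam (e y)) =
    prob R (fun y => [exists S : {set I}, (S != finset.set0) &&
      (#|neighbours (e y) S|%:R < Num.min (lam * #|S|%:R) (N%:R / 4))]).
  apply: eq_mean => y; rewrite negb_forall; congr (nat_of_bool _)%:R.
  by apply: eq_existsb => S; rewrite negb_imply -ltNge.
apply: le_trans (prob_exists _ _ _) _.
apply: (@le_trans _ _ (\sum_(S : {set I} | S != finset.set0) a ^+ #|S|)).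
  by apply: ler_sum => S _; exact: few.
have := sum_expr_card I a; rewrite (bigD1 finset.set0)//= cards0 expr0 IJ => /eqP.
rewrite eq_sym addrC -subr_eq => /eqP <-.
have : (1 + a) ^+ N <= (1 - N%:R * a)^-1.
  apply: (@le_trans _ _ (expR a ^+ N)).
    by rewrite lerXn2r ?nnegrE ?expR_ge0 ?expR_ge1Dx//; lra.
  by rewrite -expRM_natl; apply: expR_le_invB; lra.
have : (1 - N%:R * a)^-1 <= 1 + 2 * (N%:R * a).
  rewrite -[leLHS]mul1r ler_pdivrMr; last by lra.
  by have : 0 < N%:R * a by [apply: mulr_gt0]; nra.
lra.
Qed.

(** Union bound over at most [4 ^ N] pairs; each costs [96 * lam / N * (N / 4) ^+ 2 = 6 * lam * N]
    in the exponent, while [4 ^ N <= expR (2 * N)]. *)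
Lemma prob_not_well_linked (V : finType) lam I J (e : V -> I -> J -> bool) :
  (0 < #|V|)%N -> (0 < #|J|)%N -> #|I| = #|J| -> 1 <= lam ->
  sparsely_unlinked (96 * lam / #|J|%:R) e ->
  prob R (fun y => ~~ well_linked (e y)) <= expR (- (4 * lam)).
Proof.
move=> V0 J0 IJ lam1 ev; set N := #|J| in J0 IJ ev *.
have N1 : (1 : R) <= N%:R by rewrite ler1n.
pose large (AB : {set I} * {set J}) :=
  (N%:R / 4 <= #|AB.1|%:R :> R) && (N%:R / 4 <= #|AB.2|%:R :> R).
have -> : prob R (fun y => ~~ well_linked (e y)) =
    prob R (fun y => [exists AB, large AB && unlinked (e y) AB.1 AB.2]).
  apply: eq_mean => y; congr (nat_of_bool _)%:R.
  rewrite negb_forall; apply/existsP/existsP => [[A]|[[A B]]].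
    rewrite negb_forall => /existsP[B]; rewrite implybF negbK IJ => /and3P[hA hB h].
    by exists (A, B); rewrite /large hA hB.
  move=> /andP[/andP[hA hB] h]; exists A; rewrite negb_forall; apply/existsP.
  by exists B; rewrite implybF negbK IJ hA hB.
apply: le_trans (prob_exists _ _ _) _.
apply: (@le_trans _ _ (\sum_(AB | large AB) expR (- (6 * lam * N%:R)))).
  apply: ler_sum => -[A B] /andP[/= hA hB]; apply: le_trans (ev A B) _.
  rewrite ler_expR lerN2.
  have hAB : N%:R / 4 * (N%:R / 4) <= #|A|%:R * #|B|%:R :> R by apply: ler_pM => //; lra.
  have c0 : 0 <= 96 * lam / N%:R by rewrite divr_ge0//; lra.
  rewrite -[leRHS]mulrA; apply: le_trans (ler_wpM2l c0 hAB).
  by rewrite le_eqVlt; apply/orP; left; apply/eqP; field; rewrite gt_eqF//; lra.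
rewrite sumr_const -[leLHS]mulr_natl.
apply: (@le_trans _ _ (4 ^+ N * expR (- (6 * lam * N%:R)))).
  rewrite ler_pM2r ?expR_gt0// -natrX ler_nat (leq_trans (max_card _))//.
  by rewrite card_prod !card_set_type IJ -expnMn.
apply: (@le_trans _ _ (expR (2 * N%:R) * expR (- (6 * lam * N%:R)))).
  by rewrite ler_pM2r ?expR_gt0//; exact: expr4_le_expR.
by rewrite -expRD ler_expR; nra.
Qed.

(** Expansion is required in both directions because a cycle is grown forwards and backwards from
    one row; [well_linked] joins the two ends. *)
Definition richly_linked lam I J (e : I -> J -> bool) : bool :=
  [&& expanding lam e, expanding lam (fun j i => e i j) & well_linked e].

Lemma prob_not_richly_linked (V : finType) lam I J (e : V -> I -> J -> bool) :
  (0 < #|V|)%N -> (2 < #|J|)%N -> #|I| = #|J| ->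
  1 <= lam -> #|J|%:R <= expR lam ->
  sparsely_unlinked (96 * lam / #|J|%:R) e ->
  prob R (fun y => ~~ richly_linked lam (e y)) <= expR (- (3 * lam)).
Proof.
move=> V0 J2 IJ lam1 Jlam ev.
have p1 := prob_not_expanding V0 (ltnW J2) IJ lam1 Jlam ev.
have p2 : prob R (fun y => ~~ expanding lam (fun j i => e y i j))
    <= 2 * expR (- (29 * lam)).
  apply: prob_not_expanding => //; rewrite ?IJ//; first exact: ltnW.
  exact: sparsely_unlinked_flip.
have p3 := prob_not_well_linked V0 (ltnW (ltnW J2)) IJ lam1 ev.
have : prob R (fun y => ~~ richly_linked lam (e y)) <=
    2 * expR (- (29 * lam)) + (2 * expR (- (29 * lam)) + expR (- (4 * lam))).
  apply: le_trans (lerD p1 (lerD p2 p3)).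
  have := probU R (fun y => ~~ expanding lam (fun j i => e y i j))
    (fun y => ~~ well_linked (e y)).
  move=> /(lerD (lexx (prob R (fun y => ~~ expanding lam (e y))))) h.
  apply: le_trans h; apply: le_trans (probU _ _ _).
  by apply: ler_prob => y; rewrite /= !negb_and.
move=> /le_trans; apply.
(* Since [expR (- lam) <= 1/3], the three terms sum to at most [4/9 + 1/3 < 1] times
   [expR (- (3 * lam))]. *)
have e3 : 3 <= expR lam by apply: le_trans Jlam; rewrite ler_nat.
pose x := expR (- lam).
have x0 : 0 < x by exact: expR_gt0.
have x3 : x <= 3^-1 by rewrite /x expRN lef_pV2// posrE// expR_gt0.
have h4 : expR (- (4 * lam)) = x * expR (- (3 * lam)).
  by rewrite /x -expRD; congr expR; ring.
have h5 : expR (- (29 * lam)) <= x * x * expR (- (3 * lam)).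
  by rewrite /x -!expRD ler_expR; lra.
have y0 := expR_gt0 (- (3 * lam)); rewrite h4.
have xy : x * expR (- (3 * lam)) <= 3^-1 * expR (- (3 * lam)) by rewrite ler_pM2r.
have xx : x * x <= 9^-1 by nra.
have : x * x * expR (- (3 * lam)) <= 9^-1 * expR (- (3 * lam)) by rewrite ler_pM2r.
lra.
Qed.

End random_bipartite_graph.

(** * Short alternating cycles *)

Section alternating_cycle.
Variables (R : realType) (I J : finType) (e : I -> J -> bool) (lam : R).
Variable tau : I -> J.
Hypotheses (IJ : #|I| = #|J|) (lam1 : 1 <= lam) (tau_inj : injective tau).
Hypothesis rich : richly_linked lam e.

(* Along a cycle of this relation, [tau] can be replaced by edges of [e]. *)
Definition alternate (i i' : I) : bool := e i (tau i').

(** Endpoints of walks with exactly [n] steps, not vertices at distance [n]: repetitions are allowed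
    here and removed only in [short_cycle]. *)
Fixpoint ahead (n : nat) (i0 : I) : {set I} :=
  if n is n'.+1 then tau @^-1: neighbours e (ahead n' i0) else [set i0]%SET.

Fixpoint behind (n : nat) (i0 : I) : {set I} :=
  if n is n'.+1 then neighbours (fun j i => e i j) (tau @: behind n' i0)%SET
  else [set i0]%SET.

(** One expansion step, in a form that iterates: the lower bound grows by a factor [lam] until it
    saturates at a quarter of the other side. *)
Lemma expanding_card_gt (K L : finType) (f : K -> L -> bool) (S : {set K}) (b : R) :
  (0 < #|L|)%N -> 1 <= b -> expanding lam f ->
  Num.min b (#|L|%:R / 4) <= #|S|%:R ->
  Num.min (lam * b) (#|L|%:R / 4) <= #|neighbours f S|%:R.
Proof.
move=> L0 b1 /forallP/(_ S)/implyP ex bS.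
have L4 : (0 : R) < #|L|%:R / 4 by rewrite divr_gt0// ltr0n.
have S0 : S != finset.set0.
  apply/eqP => S0; move: bS; rewrite S0 cards0.
  by rewrite ge_min => /orP[]; lra.
apply: le_trans (ex S0); rewrite le_min [X in _ && X]ge_min lexx orbT andbT.
move: bS; rewrite !ge_min => /orP[bS|LS]; last first.
  by apply/orP; right; apply: (le_trans LS); rewrite ler_peMl.
by rewrite ler_pM2l ?bS//; exact: lt_le_trans lam1.
Qed.

Lemma tau_bij : bijective tau.
Proof. by apply: inj_card_bij => //; rewrite IJ. Qed.

Lemma card_ahead n i0 : Num.min (lam ^+ n) (#|J|%:R / 4) <= #|ahead n i0|%:R.
Proof.
have J0 : (0 < #|J|)%N by rewrite -IJ; apply/card_gt0P; exists i0.
elim: n => [|n ih] /=; first by rewrite cards1 ge_min expr0 lexx.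
rewrite on_card_preimset; last exact: onW_bij tau_bij.
rewrite exprS; apply: expanding_card_gt => //; first exact: exprn_ege1.
by case/and3P: rich.
Qed.

Lemma card_behind n i0 : Num.min (lam ^+ n) (#|I|%:R / 4) <= #|behind n i0|%:R.
Proof.
have I0 : (0 < #|I|)%N by apply/card_gt0P; exists i0.
elim: n => [|n ih] /=; first by rewrite cards1 ge_min expr0 lexx.
rewrite exprS; apply: expanding_card_gt => //; first exact: exprn_ege1.
  by case/and3P: rich.
by rewrite card_imset.
Qed.

Lemma ahead_path n i0 i : i \in ahead n i0 ->
  exists p, [/\ path alternate i0 p, last i0 p = i & size p = n].
Proof.
elim: n i => [|n ih] i /=; first by rewrite inE => /eqP ->; exists [::].
rewrite !inE => /existsP[i' /andP[/ih[p [pth lst sz]] ei]].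
by exists (rcons p i); rewrite rcons_path pth lst last_rcons size_rcons sz.
Qed.

Lemma behind_path n i0 i : i \in behind n i0 ->
  exists p, [/\ path alternate i p, last i p = i0 & size p = n].
Proof.
elim: n i => [|n ih] i /=; first by rewrite inE => /eqP ->; exists [::].
rewrite !inE => /existsP[j /andP[/imsetP[i' /ih[p [pth lst sz]] ->] ei]].
by exists (i' :: p); rewrite /= pth lst sz /alternate ei.
Qed.

(** After [k] steps both the forward and the backward layer of [i0] fill a quarter of the rows, so
    an edge joins them and closes a walk. *)
Lemma short_cycle k i0 : #|J|%:R / 4 <= lam ^+ k ->
  exists p, [/\ cycle alternate (i0 :: p), uniq (i0 :: p) & (size p <= k.*2)%N].
Proof.
move=> Jk.
have hA := card_ahead k i0; rewrite (min_idPr Jk) in hA.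
have hB := card_behind k i0; rewrite IJ (min_idPr Jk) -(card_imset _ tau_inj) in hB.
have /and3P[_ _ /forallP/(_ (ahead k i0))/forallP/(_ (tau @: behind k i0)%SET)] := rich.
rewrite IJ hA hB /= implybF negb_forall => /existsP[i]; rewrite negb_imply.
case/andP => /ahead_path[p [pth lst sz]].
rewrite negb_forall => /existsP[j]; rewrite negb_imply => /andP[/imsetP[i' hi' ->{j}]].
rewrite negbK => ei; have [q [qth qlst qsz]] := behind_path hi'.
(* The closed walk: [k] steps out, one joining edge, [k] steps back to [i0]. *)
have : path alternate i0 (p ++ i' :: q) by rewrite cat_path pth/= lst /alternate ei.
have : last i0 (p ++ i' :: q) = i0 by rewrite last_cat.
have : size (p ++ i' :: q) = k.*2.+1 by rewrite size_cat/= sz qsz -addnn addnS.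
(* Drop the final [i0], which [cycle] restores, then remove repetitions; [shortenP] keeps both ends,
   so the cycle still closes at [i0]. *)
case/lastP: (p ++ i' :: q) => // s x; rewrite size_rcons last_rcons => -[ss ->].
rewrite rcons_path => /andP[sth]; case/shortenP: sth => s' s'th us' sub r.
exists s'; split => //; first by rewrite /= rcons_path s'th.
rewrite -ss; apply: uniq_leq_size; last exact: sub.
by case/andP: us'.
Qed.

(* Otherwise rerouting [tau] along a short cycle through [i] would be cheaper. *)
Lemma optimal_edge_le (cost : I -> J -> R) (v : R) k i :
  (forall i j, 0 <= cost i j) -> 0 <= v -> (forall i j, e i j -> cost i j <= v) ->
  (forall tau', injective tau' ->
    \sum_i cost i (tau i) <= \sum_i cost i (tau' i)) ->
  #|J|%:R / 4 <= lam ^+ k ->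
  cost i (tau i) <= v *+ k.*2.+1.
Proof.
move=> cost0 v0 ev opt /(short_cycle i)[p [cyc up sp]].
set c := i :: p in cyc up.
(* [next c] permutes the cycle and fixes every other row. *)
have nK : injective (tau \o next c).
  by apply: inj_comp => //; exact: can_inj (prev_next up).
have := opt _ nK; rewrite (bigID (mem c))/= [X in _ <= X](bigID (mem c))/=.
have -> : \sum_(x | x \notin c) cost x (tau (next c x)) =
          \sum_(x | x \notin c) cost x (tau x).
  by apply: eq_bigr => x xc; rewrite next_nth (negPf xc).
rewrite lerD2r => h.
have : \sum_(x | x \in c) cost x (tau (next c x)) <= v *+ k.*2.+1.
  apply: (@le_trans _ _ (\sum_(x in c) v)).
    by apply: ler_sum => x xc; apply: ev; exact: (next_cycle cyc).
  by rewrite sumr_const (card_uniqP up); apply: ler_wpMn2l.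
apply: le_trans; apply: le_trans h.
by rewrite (bigD1 i) ?mem_head//= lerDl sumr_ge0.
Qed.

End alternating_cycle.

(** * Optimal assignments *)

Section assignment_cost_theory.
Variables (R : realType) (I J : finType).
Hypothesis IJ : #|I| = #|J|.

Lemma exists_injection : exists tau : I -> J, injective tau.
Proof.
exists (fun i => enum_val (cast_ord IJ (enum_rank i))) => i i'.
by move=> /enum_val_inj/cast_ord_inj/enum_rank_inj.
Qed.

Lemma assignment_costP (T : Type) (X : I * J -> T -> R) (w : T) :
  exists tau : I -> J, [/\ injective tau,
    assignment_cost X w = \sum_i X (i, tau i) w &
    forall tau', injective tau' ->
      \sum_i X (i, tau i) w <= \sum_i X (i, tau' i) w].
Proof.
have [tau0 tau0_inj] := exists_injection.
pose F (f : {ffun I -> J}) := \sum_i X (i, f i) w.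
have f0 : injectiveb (finfun tau0).
  by apply/injectiveP => i i'; rewrite !ffunE => /tau0_inj.
(* The minimum is taken over finite functions, which form a finite type, unlike [I -> J]. *)
case: (@Order.TotalTheory.arg_minP _ _ _ (finfun tau0)
  (fun f : {ffun I -> J} => injectiveb f) F f0) => /= f /injectiveP fi fmin.
have opt tau' : injective tau' -> F f <= \sum_i X (i, tau' i) w.
  move=> ti; have : injectiveb (finfun tau').
    by apply/injectiveP => i i'; rewrite !ffunE => /ti.
  move=> /fmin /le_trans; apply; rewrite /F le_eqVlt; apply/orP; left.
  by apply/eqP; apply: eq_bigr => i _; rewrite ffunE.
exists f; split => //; apply/eqP; rewrite eq_le; apply/andP; split.
  (* Both a lower bound and an element are supplied, so [inf] is a genuine infimum and not its
     default value. *)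
  apply: ge_inf; last by exists f.
  by exists (F f) => _ [tau' /opt ? <-].
apply: lb_le_inf; first by exists (F f), f.
by move=> _ [tau' /opt ? <-].
Qed.

Lemma assignment_cost_le_sum (T : Type) (X : I * J -> T -> R) (w : T) tau :
  injective tau -> assignment_cost X w <= \sum_i X (i, tau i) w.
Proof. by have [tau0 [_ -> opt]] := assignment_costP X w; exact: opt. Qed.

(** The optimal assignment for [X'] is tested on [X]. The error may depend on the row, since an
    assignment meets each row exactly once. *)
Lemma assignment_cost_leD (T T' : Type) (X : I * J -> T -> R)
    (X' : I * J -> T' -> R) (w : T) (w' : T') (eps : I -> R) :
  (forall ij, X ij w <= X' ij w' + eps ij.1) ->
  assignment_cost X w <= assignment_cost X' w' + \sum_i eps i.
Proof.
move=> XX'; have [tau [ti -> _]] := assignment_costP X' w'.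
apply: le_trans (assignment_cost_le_sum X w ti) _.
by rewrite -big_split; apply: ler_sum => i _; exact: XX'.
Qed.

End assignment_cost_theory.

(** * The discrete model and its truncation *)

Section grid.
Variables (R : realType) (I J : finType) (m : nat).
Hypothesis m0 : (0 < m)%N.

Local Notation Omega := {ffun I -> {ffun J -> 'I_m}}.
Implicit Types (y : Omega) (u v lam : R).

(** The left endpoint of the cell numbered [y i j]. The curried form of [y] makes a whole row one
    coordinate for the bounded differences. *)
Definition grid_entry (ij : I * J) y : R := (y ij.1 ij.2)%:R / m%:R.

Definition truncated_entry u (ij : I * J) y : R := Num.min (grid_entry ij y) u.

Definition grid_cost y : R := assignment_cost grid_entry y.

Definition truncated_cost u y : R := assignment_cost (truncated_entry u) y.

Lemma card_row_gt0 : (0 < #|{ffun J -> 'I_m}|)%N.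
Proof. by apply: card_ffun_gt0; rewrite card_ord. Qed.

Lemma card_grid_gt0 : (0 < #|{ffun I -> {ffun J -> 'I_m}}|)%N.
Proof. by apply: card_ffun_gt0; exact: card_row_gt0. Qed.

Lemma grid_entry_ge0 ij y : 0 <= grid_entry ij y.
Proof. by rewrite divr_ge0. Qed.

Lemma grid_entry_le1 ij y : grid_entry ij y <= 1.
Proof. by rewrite ler_pdivrMr ?ltr0n// mul1r ler_nat ltnW. Qed.

(** With [q] the integer part of [v * m], the admissible [a] are those above [q], a proportion at
    most [1 - v <= expR (- v)] unless there are none. *)
Lemma prob_gt_grid v : 0 <= v ->
  prob R (fun a : 'I_m => v < a%:R / m%:R) <= expR (- v).
Proof.
move=> v0; have mR : (0 : R) < m%:R by rewrite ltr0n.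
have vm0 : 0 <= v * m%:R by rewrite mulr_ge0// ltW.
set q := Num.trunc (v * m%:R).
have vmq : v * m%:R < q.+1%:R by exact: truncnS_gt.
have card_gt n : (\sum_(a < n) (q < a) = n - q.+1)%N.
  elim: n => [|n ih]; first by rewrite big_ord0.
  by rewrite big_ord_recr/= ih; case: ltnP => /= h; lia.
have : prob R (fun a : 'I_m => v < a%:R / m%:R) <= (m - q.+1)%:R / m%:R.
  rewrite /prob /mean card_ord -card_gt natr_sum ler_pM2r ?invr_gt0//.
  apply: ler_sum => a _; rewrite ler_nat ltr_pdivlMr//.
  case: ltrP => // va; have : q%:R < a%:R :> R.
    by apply: le_lt_trans va; rewrite truncn_le.
  by rewrite ltr_nat => ->.
move=> /le_trans; apply; have [mq|qm] := leqP m q.+1.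
  by rewrite (eqP mq) mul0r expR_ge0.
apply: le_trans (expR_ge1Dx _); rewrite natrB ?(ltnW qm)// mulrBl divff ?gt_eqF//.
by rewrite lerD2l lerN2 ler_pdivlMr// ltW.
Qed.

(** The indicator of the event is a product over the entries, so [mean_prod], applied to the rows
    and then within each row, factorises its mean. *)
Lemma sparsely_unlinked_grid v : 0 <= v ->
  sparsely_unlinked v (fun y i j => grid_entry (i, j) y <= v).
Proof.
move=> v0 S W.
pose far (b : bool) (a : 'I_m) : R := if b then (v < a%:R / m%:R)%R%:R else 1.
have -> : prob R (fun y => unlinked (fun i j => grid_entry (i, j) y <= v) S W) =
    mean (fun y : Omega => \prod_i \prod_j far ((i \in S) && (j \in W)) (y i j)).
  apply: eq_mean => y; case: (boolP (unlinked _ _ _)) => h.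
    rewrite big1// => i _; rewrite big1// => j _; rewrite /far.
    case: ifP => // /andP[iS jW].
    have /forall_inP/(_ i iS)/forall_inP/(_ j jW) := h.
    by rewrite -ltNge => ->.
  move: h; rewrite negb_forall => /existsP[i]; rewrite negb_imply => /andP[iS].
  rewrite negb_forall => /existsP[j]; rewrite negb_imply negbK => /andP[jW yv].
  by rewrite (bigD1 i)//= (bigD1 j)//= /far iS jW/= ltNge yv/= !mul0r.
rewrite (mean_prod (fun i (r : {ffun J -> 'I_m}) =>
  \prod_j far ((i \in S) && (j \in W)) (r j))).
under eq_bigr => i _ do
  rewrite (mean_prod (fun j (a : 'I_m) => far ((i \in S) && (j \in W)) a)).
have m0' : (0 < #|'I_m|)%N by rewrite card_ord.
apply: (@le_trans _ _ (\prod_i \prod_j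
    (if (i \in S) && (j \in W) then expR (- v) else 1))).
  apply: ler_prod => i _; apply/andP; split.
    apply: prodr_ge0 => j _; rewrite divr_ge0// sumr_ge0// => a _.
    by rewrite /far; case: ifP.
  apply: ler_prod => j _; apply/andP; split.
    by rewrite divr_ge0// sumr_ge0// => a _; rewrite /far; case: ifP.
  by rewrite /far; case: ifP => _; [exact: prob_gt_grid|rewrite mean_cst].
rewrite (eq_bigr (fun i => if i \in S then expR (- v) ^+ #|W| else 1)).
  rewrite -big_mkcond/= prodr_const -exprM -expRM_natl ler_expR natrM.
  by rewrite le_eqVlt; apply/orP; left; apply/eqP; ring.
move=> i _; case: (i \in S) => /=; last by rewrite big1.
by rewrite -big_mkcond/= prodr_const.
Qed.

Hypothesis IJ : #|I| = #|J|.

Lemma truncated_cost_le u y : truncated_cost u y <= grid_cost y.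
Proof.
have := @assignment_cost_leD R I J IJ _ _ (truncated_entry u) grid_entry y y (fun=> 0).
by rewrite sumr_const mul0rn !addr0; apply => ij; rewrite addr0 ge_min lexx.
Qed.

Lemma truncated_cost_ge1 u y : 1 <= u -> truncated_cost u y = grid_cost y.
Proof.
move=> u1; congr inf; apply: eq_imagel => tau _; apply: eq_bigr => i _.
by rewrite /truncated_entry (min_idPl _)// (le_trans (grid_entry_le1 _ _)).
Qed.

(** An assignment uses a single entry of the changed row, and truncated entries lie between [0] and
    [u]. *)
Lemma bounded_diff_truncated_cost u : 0 <= u ->
  bounded_diff u (truncated_cost u).
Proof.
move=> u0; have te0 ij y : 0 <= truncated_entry u ij y <= u.
  by rewrite le_min grid_entry_ge0 u0 ge_min lexx orbT.
have close y y' i : (forall k, k != i -> y k = y' k) ->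
    truncated_cost u y <= truncated_cost u y' + u.
  move=> yy'; pose eps k := if k == i then u else 0.
  have -> : truncated_cost u y' + u = truncated_cost u y' + \sum_k eps k.
    by rewrite /eps -big_mkcond big_pred1_eq.
  apply: assignment_cost_leD => // -[k j] /=; rewrite /eps.
  have [_|ki] := eqVneq k i.
    have /andP[_ yu] := te0 (k, j) y; have /andP[y'0 _] := te0 (k, j) y'.
    by rewrite (le_trans yu)// lerDr.
  by rewrite addr0 /truncated_entry /grid_entry/= yy'.
move=> y i r; rewrite ler_distl lerBlDr; apply/andP; split; apply: (close _ _ i).
  by move=> k ki; rewrite ffunE (negPf ki).
by move=> k ki; rewrite ffunE (negPf ki).
Qed.

(** [optimal_edge_le], applied to the truncated costs, shows that their optimal assignment uses only
    entries below [u]; truncation leaves these unchanged, so this assignment also bounds the grid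
    cost. *)
Lemma truncated_cost_rich lam v u k y :
  1 <= lam -> 0 <= v -> v *+ k.*2.+1 < u -> #|J|%:R / 4 <= lam ^+ k ->
  richly_linked lam (fun i j => grid_entry (i, j) y <= v) ->
  truncated_cost u y = grid_cost y.
Proof.
move=> lam1 v0 vu Jk rich; apply/eqP; rewrite eq_le truncated_cost_le/=.
have [tau [ti costE opt]] := assignment_costP IJ (truncated_entry u) y.
rewrite /truncated_cost costE.
apply: le_trans (assignment_cost_le_sum IJ _ _ ti) _.
apply: ler_sum => i _.
suff : truncated_entry u (i, tau i) y < u.
  by rewrite /truncated_entry; case: (leP (grid_entry _ _) u); rewrite ?ltxx.
apply: (le_lt_trans _ vu).
apply: (optimal_edge_le (e := fun i j => grid_entry (i, j) y <= v)
  (cost := fun i j => truncated_entry u (i, j) y) IJ lam1 ti rich) => //.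
- move=> i' j; rewrite le_min grid_entry_ge0; apply: (le_trans _ (ltW vu)).
  by rewrite mulrn_wge0.
- by move=> i' j; rewrite ge_min => ->.
Qed.

End grid.

(** * The truncation level *)

(** This is [e < 3], from [e ^ (1/6) <= 6/5] and [(6/5) ^ 6 < 3]. *)
Lemma ln_gt1 (R : realType) (x : R) : 3 <= x -> 1 < ln x.
Proof.
move=> x3; rewrite -[1]expRK ltr_ln ?posrE ?expR_gt0//; last lra.
apply: lt_le_trans x3.
have h : expR (6^-1) <= 6 / 5 :> R.
  have -> : 6 / 5 = (1 - 6^-1)^-1 :> R by field.
  by apply: expR_le_invB; lra.
rewrite [x in expR x](_ : 1 = 6%:R * 6^-1); last by rewrite divff.
rewrite expRM_natl; apply: (@le_lt_trans _ _ ((6 / 5) ^+ 6)).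
  by rewrite lerXn2r ?nnegrE ?expR_ge0//; lra.
lra.
Qed.

(** Here [576 = 96 * 6]: edges of cost at most [96 * lam / N], along a cycle with fewer than
    [6 * ln N / ln lam] of them. *)
Definition edge_bound (R : realType) (N lam : R) : R :=
  576 * (lam * ln N / (N * ln lam)).

Section edge_bound_theory.
Variables (R : realType) (N lam : R).
Hypotheses (N3 : 3 <= N) (Nlam : ln N <= lam).

Let lnN1 : 1 < ln N. Proof. exact: ln_gt1. Qed.
Let lam1 : 1 < lam. Proof. exact: lt_le_trans Nlam. Qed.
Let N0 : 0 < N. Proof. exact: lt_le_trans N3. Qed.
Let lnN0 : 0 < ln N. Proof. exact: lt_trans lnN1. Qed.
Let lam0 : 0 < lam. Proof. exact: lt_trans lam1. Qed.
Let lnlam0 : 0 < ln lam. Proof. exact: ln_gt0. Qed.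

Lemma edge_bound_gt0 : 0 < edge_bound N lam.
Proof. by rewrite /edge_bound mulr_gt0// divr_gt0// mulr_gt0. Qed.

(** In this range truncation is vacuous. With [r = lam / N >= 1],
    [ln lam <= ln N + (r - 1) <= r * ln N], because [ln N > 1]. *)
Lemma edge_bound_ge1 : N <= lam -> 1 <= edge_bound N lam.
Proof.
move=> Nl; rewrite /edge_bound.
suff : 1 <= lam * ln N / (N * ln lam) by lra.
rewrite ler_pdivlMr ?mulr_gt0// mul1r.
have r1 : 1 <= lam / N by rewrite ler_pdivlMr ?mul1r.
have -> : lam = N * (lam / N) by rewrite mulrC divfK// gt_eqF.
rewrite -mulrA ler_pM2l// lnM ?posrE//; last exact: divr_gt0.
set r := lam / N in r1 *.
have : ln (1 + (r - 1)) <= r - 1 by apply: le_ln1Dx; lra.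
have := lnN1; rewrite addrC subrK; nra.
Qed.

Lemma exists_edge_steps : lam < N -> exists k : nat,
  N <= lam ^+ k /\ (96 * lam / N) *+ k.*2.+1 < edge_bound N lam.
Proof.
move=> lN.
set q := ln N / ln lam.
have q1 : 1 <= q by rewrite ler_pdivlMr// mul1r ler_ln ?posrE// ltW.
have qE : q * ln lam = ln N by rewrite divfK// gt_eqF.
(* Then [k > q], whence [lam ^+ k >= N], while [2 * k + 1 <= 2 * q + 3 <= 5 * q] since [q >= 1]. *)
exists (Num.trunc q).+1; split.
  rewrite -ler_ln ?posrE ?exprn_gt0// lnXn//.
  rewrite -mulr_natl -qE ler_pM2r//; apply/ltW.
  by have /andP[] := truncn_itv (le_trans ler01 q1).
have kq : (Num.trunc q)%:R <= q by rewrite truncn_le; lra.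
rewrite /edge_bound (_ : lam * ln N / (N * ln lam) = (lam / N) * q); last first.
  by rewrite /q; field; rewrite !gt_eqF.
rewrite -mulr_natr (_ : (_.*2.+1)%:R = 2 * (Num.trunc q)%:R + 3 :> R); last first.
  by rewrite doubleS -addnn !mulrS natrD; ring.
have : 0 < lam / N by exact: divr_gt0.
set z := lam / N; rewrite -[96 * lam / N]mulrA -/z => z0.
nra.
Qed.

End edge_bound_theory.

(** * Concentration of the grid cost *)

Section grid_concentration.
Variables (R : realType) (I J : finType) (m : nat).
Hypotheses (IJ : #|I| = #|J|) (m0 : (0 < m)%N) (J3 : (3 <= #|J|)%N).
Variable lam : R.
Hypothesis Jlam : ln #|J|%:R <= lam.

Local Notation Omega := {ffun I -> {ffun J -> 'I_m}}.
Local Notation N := (#|J|%:R : R).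
Local Notation u := (edge_bound N lam).

Let N3 : 3 <= N. Proof. by rewrite ler_nat. Qed.

Let lam1 : 1 < lam. Proof. exact: lt_le_trans (ln_gt1 N3) Jlam. Qed.

Let N0 : 0 < N. Proof. exact: lt_le_trans N3. Qed.

Let u0 : 0 < u. Proof. exact: edge_bound_gt0. Qed.

Lemma prob_truncated_cost_neq :
  prob R (fun y : Omega => truncated_cost u y != grid_cost R y) <= expR (- (3 * lam)).
Proof.
have [Nl|lN] := lerP N lam.
  rewrite (_ : prob R _ = 0) ?expR_ge0//.
  rewrite -(mean_cst (card_grid_gt0 I J m0) 0); apply: eq_mean => y.
  by rewrite truncated_cost_ge1 ?eqxx// edge_bound_ge1.
have [k [Nk ku]] := exists_edge_steps N3 Jlam lN.
have v0 : 0 <= 96 * lam / N.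
  by rewrite divr_ge0// mulr_ge0// (le_trans ler01)// ltW.
have Nexp : N <= expR lam by rewrite -[leLHS]lnK ?posrE// ler_expR.
have := prob_not_richly_linked (card_grid_gt0 I J m0) J3 IJ (ltW lam1) Nexp
  (sparsely_unlinked_grid m0 v0).
move=> h; apply: le_trans h; apply: ler_prob => y; apply: contra => rich.
apply/eqP; apply: (truncated_cost_rich IJ (ltW lam1) v0 ku _ rich).
by apply: le_trans Nk; rewrite ler_pdivrMr// ler_peMr// ler1n.
Qed.

(** [M] is a median of the grid cost only up to [delta], the later rounding error. Concentration
    around the mean [mu] of the truncated cost is transferred to [M] by bounding the distance
    between [mu] and [M]. *)
Lemma prob_grid_cost_far (M t delta : R) :
  2^-1 <= prob R (fun y : Omega => grid_cost R y <= M) ->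
  2^-1 <= prob R (fun y : Omega => M - delta <= grid_cost R y) ->
  0 <= t -> 2^-1 <= t ^+ 2 -> t ^+ 2 <= lam ->
  0 <= delta -> delta <= t * (u * Num.sqrt N) ->
  prob R (fun y : Omega => 20 * (t * (u * Num.sqrt N)) - delta <= `|grid_cost R y - M|)
    <= 2 * expR (- t ^+ 2).
Proof.
move=> medl medr t0 tt tlam d0 dt.
have I0 : (0 < #|I|)%N by rewrite IJ (leq_trans _ J3).
have NI : #|I|%:R = N by rewrite IJ.
have bd := bounded_diff_truncated_cost (m := m) IJ (ltW u0).
set f := truncated_cost u in bd; set mu := mean (f : Omega -> R).
set sg := u * Num.sqrt N in dt *.
have sg0 : 0 < sg by rewrite mulr_gt0// sqrtr_gt0.
have sgE s : (s * sg) ^+ 2 / (12 * N * u ^+ 2) = s ^+ 2 / 12.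
  have cancel (a b : R) : 0 < a -> 0 < b ->
      (s * (a * Num.sqrt b)) ^+ 2 / (12 * b * a ^+ 2) = s ^+ 2 / 12.
    move=> a0 b0; rewrite !exprMn sqr_sqrtr; last exact: ltW.
    by field; rewrite !gt_eqF.
  exact: cancel.
have upper s : 0 <= s ->
    prob R (fun y : Omega => mu + s * sg <= f y) <= expR (- (s ^+ 2 / 12)).
  move=> s0; have := bounded_diff_upper_tail (card_row_gt0 J m0) I0 u0
    (mulr_ge0 s0 (ltW sg0)) bd.
  by rewrite NI sgE.
have lower s : 0 <= s ->
    prob R (fun y : Omega => f y <= mu - s * sg) <= expR (- (s ^+ 2 / 12)).
  move=> s0; have := bounded_diff_lower_tail (card_row_gt0 J m0) I0 u0
    (mulr_ge0 s0 (ltW sg0)) bd.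
  by rewrite NI sgE.
pose bad y := f y != grid_cost R y.
have pbad : prob R bad <= expR (- (3 * lam)) by exact: prob_truncated_cost_neq.
have e3 : expR (- 3) <= 8^-1 :> R.
  rewrite expRN lef_pV2 ?posrE ?expR_gt0// -[3]mulr1 expRM_natl.
  rewrite (_ : 8 = 2 ^+ 3); last by ring.
  by rewrite lerXn2r ?nnegrE ?expR_ge0// expR1_ge2.
have e3lam : expR (- (3 * lam)) <= 8^-1.
  by apply: le_trans e3; have := lam1; rewrite ler_expR; lra.
have six : 6 ^+ 2 / 12 = 3 :> R by field.
(* Otherwise a tail of probability at most [expR (- 3) < 1/2] would contain a median event. The
   exceptional event [bad] enters only in [mu_ge], as truncation never raises the cost. *)
have mu_le : mu <= M + 6 * sg.
  rewrite leNgt; apply/negP => Mmu.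
  have : prob R (fun y : Omega => grid_cost R y <= M) <= expR (- 3).
    rewrite -six; apply: le_trans (lower 6 _); last by [].
    by apply: ler_prob => y yM; have := truncated_cost_le IJ u y; rewrite -/f; lra.
  lra.
have mu_ge : M - delta - 6 * sg <= mu.
  rewrite leNgt; apply/negP => Mmu.
  have : prob R (fun y : Omega => M - delta <= grid_cost R y) <=
      expR (- (3 * lam)) + expR (- 3).
    have := upper 6 (ler0n R 6); rewrite six => upper6.
    apply: le_trans (lerD pbad upper6).
    apply: le_trans (probU _ _ _); apply: ler_prob => y /= yM.
    by rewrite /bad; case: eqP => //= ->; lra.
  lra.
have t12 : 2^-1 <= t by nra.
have tsg : 2^-1 * sg <= t * sg by rewrite ler_pM2r.
(* The budget is [20 = 12 + 6 + 2]: [6 * sg <= 12 * (t * sg)] for the distance from [mu] to [M], [6]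
   for the deviation from [mu], and [2] for two errors [delta]. *)
have : prob R (fun y : Omega => 20 * (t * sg) - delta <= `|grid_cost R y - M|) <=
    expR (- (3 * lam)) + (expR (- ((6 * t) ^+ 2 / 12)) + expR (- ((6 * t) ^+ 2 / 12))).
  have t6 : 0 <= 6 * t by lra.
  apply: le_trans (lerD pbad (lerD (upper _ t6) (lower _ t6))).
  have := lerD (lexx (prob R bad)) (probU R (fun y : Omega => mu + 6 * t * sg <= f y)
    (fun y => f y <= mu - 6 * t * sg)).
  move=> h; apply: le_trans h; apply: le_trans (probU _ _ _).
  apply: ler_prob => y /=; rewrite /bad; case: eqP => //= <-.
  rewrite ler_normr => /orP[h|h]; apply/orP; [left|right]; lra.
move=> /le_trans; apply.
have -> : (6 * t) ^+ 2 / 12 = 3 * t ^+ 2 by field.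
have : expR (- (3 * lam)) <= expR (- (3 * t ^+ 2)) by rewrite ler_expR; lra.
have -> : - (3 * t ^+ 2) = - (2 * t ^+ 2) - t ^+ 2 by ring.
rewrite expRD.
(* Since [t ^+ 2 >= 1/2], the three terms sum to at most [3/2] times [expR (- t ^+ 2)]. *)
have : expR (- (2 * t ^+ 2)) <= 2^-1.
  apply: (@le_trans _ _ (expR (- 1))); first by rewrite ler_expR; lra.
  by rewrite expRN lef_pV2 ?posrE ?expR_gt0// expR1_ge2.
have := expR_gt0 (- t ^+ 2); nra.
Qed.

End grid_concentration.

(** * From continuous entries to the grid *)

Section discretisation.
Variables (d : measure_display) (T : measurableType d) (R : realType).
Variable P : probability T R.

Lemma measure_cover_le (K : Type) (s : seq K) (A : K -> set T) (B : set T) :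
  measurable B -> (forall k, measurable (A k)) ->
  B `<=` \big[setU/classical_sets.set0]_(k <- s) A k ->
  (P B <= \sum_(k <- s) P (A k))%E.
Proof.
move=> mB mA; have mU : measurable (\big[setU/classical_sets.set0]_(k <- s) A k).
  exact: bigsetU_measurable.
move=> BA; apply: le_trans (_ : P (\big[setU/classical_sets.set0]_(k <- s) A k) <= _)%E.
  by apply: le_measure; rewrite ?inE.
elim: s {mU BA} => [|k s ih]; first by rewrite !big_nil measure0.
rewrite !big_cons; apply: le_trans (leeD2l _ ih).
by apply: measureU2 => //; exact: bigsetU_measurable.
Qed.

Lemma uniform01_itv (X : {RV P >-> R}) (a b : R) : uniform01 X ->
  0 <= a -> a <= b -> b <= 1 -> P (X @^-1` `[a, b[) = (b - a)%:E.
Proof.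
move=> Xu a0 ab b1; have -> : P (X @^-1` `[a, b[) = distribution P X `[a, b[ by [].
rewrite Xu// /uniform_prob.
rewrite (eq_integral (cst 1%E)); last first.
  move=> x; rewrite inE/= in_itv/= => /andP[ax xb]; rewrite /uniform_pdf.
  by rewrite (le_trans a0 ax) (ltW (lt_le_trans xb b1)) subr0 invr1.
rewrite integral_cst//= mul1e lebesgue_measure_itv/= lte_fin.
have [//|ba] := ltP a b; last by rewrite (@le_anti _ _ a b) ?ab// subrr.
Qed.

Variables (I J : finType) (X : I * J -> {RV P >-> R}).
Hypotheses (Xind : independent_RVs X) (Xu : forall ij, uniform01 (X ij)).
Variable m : nat.
Hypothesis m0 : (0 < m)%N.

Local Notation Omega := {ffun I -> {ffun J -> 'I_m}}.

Definition in_cell (y : Omega) (w : T) : Prop := forall ij,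
  grid_entry R ij y <= X ij w < grid_entry R ij y + m%:R^-1.

Let mR : (0 : R) < m%:R. Proof. by rewrite ltr0n. Qed.

Let cell (y : Omega) (ij : I * J) : set R :=
  `[grid_entry R ij y, grid_entry R ij y + m%:R^-1[.

Lemma in_cellE y :
  in_cell y =
  \bigcap_(ij in [set` [fset ij in enum {: I * J}]%fset]) (X ij @^-1` cell y ij).
Proof.
rewrite predeqE => w; split=> h ij.
  by move=> _; rewrite /cell/= in_itv; exact: h.
by have := h ij; rewrite /cell/= in_itv/= !inE mem_enum; exact.
Qed.

Lemma measurable_in_cell y : measurable (in_cell y).
Proof.
rewrite in_cellE; apply: fin_bigcap_measurable => // ij _.
by apply: measurable_funPTI; exact: measurable_itv.
Qed.

(** Independence gives every cell the same weight, so counting cells computes probabilities. *)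
Lemma probability_in_cell y : P (in_cell y) = (#|{: Omega}|%:R^-1)%:E.
Proof.
rewrite in_cellE Xind => [|ij _]; last exact: measurable_itv.
rewrite (eq_bigr (fun=> (m%:R^-1)%:E)); last first.
  move=> ij _; rewrite uniform01_itv//.
  - by rewrite addrC addKr.
  - exact: grid_entry_ge0.
  - by rewrite lerDl invr_ge0 ltW.
  rewrite /grid_entry -[X in _ + X]mul1r -mulrDl ler_pdivrMr// mul1r.
  by rewrite natr1 ler_nat.
rewrite prodEFin (perm_big (enum {: I * J})); last first.
  by apply: uniq_perm; rewrite ?fset_uniq ?enum_uniq// => ij; rewrite !inE.
rewrite big_enum prodr_const card_prod !card_ffun card_ord exprVn -natrX.
by rewrite -expnM mulnC.
Qed.

(** [Q] is covered by the cells that meet it, together with the null event that some entry leaves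
    [[0, 1[]. *)
Lemma probability_le_prob (Q : set T) : measurable Q ->
  (P Q <= (prob R (fun y : Omega => `[< exists2 w, Q w & in_cell y w >]))%:E)%E.
Proof.
move=> mQ; set h := fun y => _.
pose outside ij := X ij @^-1` (~` `[0, 1[).
have mo ij : measurable (outside ij).
  by apply: measurable_funPTI; exact: measurableC.
have P_outside ij : P (outside ij) = 0.
  rewrite /outside -preimage_setC probability_setC.
    by rewrite uniform01_itv// subr0 subee.
  exact: measurable_funPTI.
have cover : Q `<=` (\big[setU/classical_sets.set0]_(y <- enum h) in_cell y) `|`
    \big[setU/classical_sets.set0]_(ij <- enum {: I * J}) outside ij.
  move=> w Qw; have [[ij wij]|win] := pselect (exists ij, outside ij w).
    right; rewrite -bigcup_seq; exists ij => //=; rewrite mem_enum//.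
  left; have X01 ij : 0 <= X ij w < 1.
    apply/negP => hn; apply: win; exists ij; rewrite /outside/= in_itv/=.
    exact: hn.
  have aP ij : (Num.trunc (X ij w * m%:R) < m)%N.
    have /andP[X0 X1] := X01 ij.
    by rewrite truncn_lt_nat ?mulr_ge0// gtr_pMl.
  pose y : Omega := [ffun i => [ffun j => Ordinal (aP (i, j))]].
  have yw : in_cell y w.
    move=> [i j]; rewrite /grid_entry/= !ffunE/=.
    have /andP[X0 X1] := X01 (i, j).
    have /andP[t1 t2] := truncn_itv (mulr_ge0 X0 (ltW mR)).
    rewrite -[X in _ + X]mul1r -mulrDl ler_pdivrMr// ltr_pdivlMr// t1/=.
    by rewrite natr1.
  rewrite -bigcup_seq; exists y => //=; rewrite mem_enum.
  by apply/asboolP; exists w.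
(* The sum type merges the cells and the null events into one cover. *)
pose A (k : Omega + I * J) := match k with inl y => in_cell y | inr ij => outside ij end.
have mA k : measurable (A k) by case: k => [y|ij]; [exact: measurable_in_cell|exact: mo].
pose s := [seq (inl y : Omega + I * J) | y <- enum h] ++
          [seq (inr ij : Omega + I * J) | ij <- enum {: I * J}].
apply: le_trans (measure_cover_le (s := s) mQ mA _) _.
  by rewrite /s big_cat (big_map inl) (big_map inr); exact: cover.
rewrite /s big_cat (big_map inl) (big_map inr)/= [X in (_ + X)%E]big1 ?adde0; last first.
  by move=> ij _; exact: P_outside.
under eq_bigr do rewrite probability_in_cell.
rewrite sumEFin lee_fin big_enum sumr_const prob_card.
by rewrite -[leLHS]mulr_natl.
Qed.

End discretisation.

(** * Concentration of the assignment cost *)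

Section assignment_concentration.
Variables (R : realType) (I J : finType).
Variables (d : measure_display) (T : measurableType d) (P : probability T R).
Variable X : I * J -> {RV P >-> R}.
Hypothesis IJ : #|I| = #|J|.

Let L := assignment_cost X.

Let total (tau : {ffun I -> J}) (w : T) : R := \sum_i X (i, tau i) w.

Lemma measurable_total tau : measurable_fun setT (total tau).
Proof. by apply: measurable_sum => i; exact: measurable_funP. Qed.

(** As the infimum is attained, the sublevel set is a finite union of sublevel sets of measurable
    sums. *)
Lemma measurable_cost_le a : measurable [set w | L w <= a].
Proof.
have -> : [set w | L w <= a] =
    \bigcup_(tau in [set tau : {ffun I -> J} | injective tau]) [set w | total tau w <= a].
  rewrite predeqE => w; split=> /= [|[tau ti] h].
    rewrite /L; have [tau [ti -> _]] := assignment_costP IJ X w => h.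
    exists (finfun tau); first by move=> i i'; rewrite !ffunE => /ti.
    by rewrite /= /total; under eq_bigr do rewrite ffunE.
  exact: le_trans (assignment_cost_le_sum IJ X w ti) h.
apply: fin_bigcup_measurable => [|tau _]; first exact: finite_finset.
rewrite -[X in measurable X]setTI.
have -> : [set w | total tau w <= a] = total tau @^-1` `]-oo, a].
  by rewrite predeqE => w /=; rewrite in_itv.
by apply: measurable_total.
Qed.

Lemma measurable_cost_ge a : measurable [set w | a <= L w].
Proof.
have -> : [set w | a <= L w] =
    \bigcap_(tau in [set tau : {ffun I -> J} | injective tau]) [set w | a <= total tau w].
  rewrite predeqE => w; split=> /= [h tau ti|h].
    exact: le_trans h (assignment_cost_le_sum IJ X w ti).
  rewrite /L; have [tau [ti -> _]] := assignment_costP IJ X w.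
  have -> : \sum_i X (i, tau i) w = total (finfun tau) w.
    by apply: eq_bigr => i _; rewrite ffunE.
  by apply: h => i i'; rewrite !ffunE => /ti.
apply: fin_bigcap_measurable => [|tau _]; first exact: finite_finset.
rewrite -[X in measurable X]setTI.
have -> : [set w | a <= total tau w] = total tau @^-1` `[a, +oo[.
  by rewrite predeqE => w /=; rewrite in_itv/= andbT.
by apply: measurable_total.
Qed.

Lemma measurable_cost_far M a : measurable [set w | a <= `|L w - M|].
Proof.
have -> : [set w | a <= `|L w - M|] = [set w | M + a <= L w] `|` [set w | L w <= M - a].
  rewrite predeqE => w /=; rewrite ler_normr; split=> [/orP[]|[]] h.
  - by left; lra.
  - by right; lra.
  - by apply/orP; left; lra.
  - by apply/orP; right; lra.
by apply: measurableU; [exact: measurable_cost_ge|exact: measurable_cost_le].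
Qed.

Lemma in_cell_cost m (y : {ffun I -> {ffun J -> 'I_m}}) w : in_cell X y w ->
  grid_cost R y <= L w <= grid_cost R y + #|J|%:R / m%:R.
Proof.
move=> yw; apply/andP; split.
  have := @assignment_cost_leD R I J IJ _ _ (grid_entry R (m := m)) X y w (fun=> 0).
  rewrite sumr_const mul0rn addr0; apply => ij; rewrite addr0.
  by have /andP[] := yw ij.
have := @assignment_cost_leD R I J IJ _ _ X (grid_entry R (m := m)) w y (fun=> m%:R^-1).
rewrite sumr_const IJ -[X in _ + X]mulr_natl; apply => ij.
by have /andP[_ /ltW] := yw ij.
Qed.

Hypotheses (Xind : independent_RVs X) (Xu : forall ij, uniform01 (X ij)).
Hypothesis J3 : (3 <= #|J|)%N.
Variable M : R.
Hypothesis med : is_median P L M.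

Lemma probability_cost_far (lam t : R) :
  ln #|J|%:R <= lam -> 0 <= t -> t ^+ 2 <= lam ->
  (P [set w | (20 * (t * (edge_bound #|J|%:R lam * Num.sqrt #|J|%:R)) <= `|L w - M|)%R]
   <= (2 * expR (- t ^+ 2))%R%:E)%E.
Proof.
move=> Jlam t0 tlam; set N : R := #|J|%:R in Jlam *.
have N3 : 3 <= N by rewrite ler_nat.
(* For [t ^+ 2 < 1/2] the claimed bound exceeds [1]. *)
have [tt|tt] := ltP (t ^+ 2) (2^-1).
  apply: le_trans (probability_le1 P (measurable_cost_far _ _)) _.
  by rewrite lee_fin; have := expR_ge1Dx (- t ^+ 2); lra.
set D := t * (edge_bound N lam * Num.sqrt N).
have tpos : 0 < t.
  by rewrite lt_neqAle t0 andbT; apply/eqP => t00; move: tt; rewrite -t00; lra.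
have D0 : 0 < D.
  by rewrite mulr_gt0// mulr_gt0 ?edge_bound_gt0// sqrtr_gt0; lra.
(* Any [m >= N / D] brings the total rounding error [N / m] below the deviation scale [D]. *)
set m := (Num.trunc (N / D)).+1.
have mR : (0 : R) < m%:R by rewrite ltr0n.
have mD : N / m%:R <= D.
  have ND : 0 <= N / D by rewrite divr_ge0// ltW.
  have /andP[_ h] := truncn_itv ND; rewrite ler_pdivrMr// mulrC -ler_pdivrMr//.
  exact: ltW.
have hits Q := probability_le_prob Xind Xu (ltn0Sn _ : (0 < m)%N) (Q := Q).
have medl : 2^-1 <= prob R (fun y : {ffun I -> {ffun J -> 'I_m}} => grid_cost R y <= M).
  rewrite -lee_fin; apply: le_trans (proj1 med) _.
  apply: le_trans (hits _ (measurable_cost_le M)) _; rewrite lee_fin.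
  apply: ler_prob => y /asboolP[w /= wM /in_cell_cost/andP[yw _]].
  exact: le_trans wM.
(* Rounding down lowers the cost by at most [N / m], so only this half of the median condition is
   weakened. *)
have medr : 2^-1 <= prob R (fun y : {ffun I -> {ffun J -> 'I_m}} =>
    M - N / m%:R <= grid_cost R y).
  rewrite -lee_fin; apply: le_trans (proj2 med) _.
  apply: le_trans (hits _ (measurable_cost_ge M)) _; rewrite lee_fin.
  apply: ler_prob => y /asboolP[w /= wM /in_cell_cost/andP[_ yw]].
  by rewrite lerBlDr; exact: le_trans yw.
have d0 : 0 <= N / m%:R by rewrite divr_ge0// ltW.
apply: le_trans (hits _ (measurable_cost_far _ _)) _; rewrite lee_fin.
apply: le_trans (prob_grid_cost_far IJ (ltn0Sn _) J3 Jlam medl medr t0 tt tlam d0 mD).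
apply: ler_prob => y /asboolP[w /= wM /in_cell_cost/andP[yw1 yw2]].
rewrite lerBlDr; apply: (le_trans wM).
have -> : L w - M = (grid_cost R y - M) + (L w - grid_cost R y) by ring.
apply: le_trans (ler_normD _ _) _.
by rewrite lerD2l ger0_norm ?subr_ge0// lerBlDl.
Qed.

End assignment_concentration.

Theorem theorem10p5 (R : realType) :
  exists K : R,
  forall (N : nat), (3 <= N)%N ->
  forall (I J : finType), #|I| = N -> #|J| = N ->
  forall (d : measure_display) (T : measurableType d) (P : probability T R)
    (X : I * J -> {RV P >-> R}),
    independent_RVs X ->
    (forall ij : I * J, uniform01 (X ij)) ->
  forall M : R, is_median P (assignment_cost X) M ->
    (forall t : R, 0 <= t -> t <= Num.sqrt (ln N%:R) ->
      (P [set w | ((K * t * ln N%:R ^+ 2) / (Num.sqrt N%:R * ln (ln N%:R))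
                  <= `|assignment_cost X w - M|)%R]
       <= (2 * expR (- t ^+ 2))%R%:E)%E) /\
    (forall t : R, Num.sqrt (ln N%:R) <= t ->
      (P [set w | ((K * t ^+ 3 * ln N%:R) / (Num.sqrt N%:R * ln (t ^+ 2))
                  <= `|assignment_cost X w - M|)%R]
       <= (2 * expR (- t ^+ 2))%R%:E)%E).
Proof.
(* [20] comes from the deviation estimate and [576] from [edge_bound]. *)
exists (20 * 576) => N N3 I J IN JN d T P X Xind Xu M med.
have IJ : #|I| = #|J| by rewrite IN JN.
have J3 : (3 <= #|J|)%N by rewrite JN.
have main := probability_cost_far IJ Xind Xu J3 med; rewrite JN in main.
have NR3 : (3 : R) <= N%:R by rewrite ler_nat.
have lnN1 := ln_gt1 NR3.
have lnN0 : (0 : R) <= ln N%:R by apply: ltW; exact: lt_trans lnN1.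
have boundE (lam t : R) : ln N%:R <= lam ->
    20 * (t * (edge_bound N%:R lam * Num.sqrt N%:R)) =
    20 * 576 * t * lam * ln N%:R / (Num.sqrt N%:R * ln lam).
  move=> Nlam; rewrite /edge_bound.
  have s0 : 0 < Num.sqrt N%:R :> R by rewrite sqrtr_gt0; lra.
  have l0 : 0 < ln lam by apply: ln_gt0; exact: lt_le_trans Nlam.
  (* Writing [N] as the square of its root cancels one factor [Num.sqrt N]. *)
  rewrite -[X in lam * ln N%:R / (X * _)]sqr_sqrtr; last lra.
  by field; rewrite !gt_eqF.
split=> t.
  move=> t0 tN; have tlam : t ^+ 2 <= ln N%:R.
    by rewrite -(sqr_sqrtr lnN0) lerXn2r// nnegrE// sqrtr_ge0.
  have := main _ t (lexx _) t0 tlam; rewrite boundE//.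
  by rewrite (expr2 (ln N%:R)) mulrA.
move=> Nt; have t0 : 0 <= t := le_trans (sqrtr_ge0 _) Nt.
have lamt : ln N%:R <= t ^+ 2.
  by rewrite -(sqr_sqrtr lnN0) lerXn2r// nnegrE// sqrtr_ge0.
have := main _ t lamt t0 (lexx _); rewrite boundE//.
by rewrite (exprS t 2) mulrA.
Qed.
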